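(* Let $q \geq 5$ be a prime power and let $k \geq 1$. Then the chromatic number of the $q$-Kneser graph $qK_{2k:k}$ is $q^k + q^{k-1}$.
   Context: For a prime power $q$ and $n \geq 2k$, the $q$-Kneser graph $qK_{n:k}$ has as vertices the $k$-dimensional subspaces of $\mathbb{F}_q^n$, two vertices being adjacent if they intersect trivially (only in the zero vector). Here $n = 2k$. *)

(* Defs.v *)
From HB Require Import structures.
From mathcomp Require Import all_boot all_order all_algebra.

Set Implicit Arguments.
Unset Strict Implicit.
Unset Printing Implicit Defensive.

Section Colouring.
Variables (V : Type) (adj : rel V).

Definition proper_colouring (m : nat) (c : V -> 'I_m) : Prop :=
  forall u v : V, adj u v -> c u <> c v.

Definition colourable (m : nat) : Prop :=
  exists c : V -> 'I_m, proper_colouring c.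

Definition is_chromatic_number (m : nat) : Prop :=
  colourable m /\ forall m' : nat, colourable m' -> m <= m'.

End Colouring.

Section QKneser.
Variables (F : finFieldType) (n k : nat).

Definition qKneser_vertex : Type :=
  {U : {vspace 'rV[F]_n} | \dim U == k}.

(* For k = 0 the only vertex, the zero subspace, is related to itself; for
   k >= 1 this relation is irreflexive. *)
Definition qKneser : rel qKneser_vertex :=
  fun U W => (val U :&: val W)%VS == 0%VS.

End QKneser.

(* Main.v *)
Require Import Defs.
From HB Require Import structures.
From mathcomp Require Import all_boot all_order all_algebra.
From mathcomp Require Import all_field.
From mathcomp Require Import zify ring.

(** A colour class is an intersecting family of [k]-spaces. Write [f] for the
    number of [k]-spaces on a point, which is also the number of [k]-spaces in a
    hyperplane.

    An intersecting family [Y] whose members have no common point and lie in no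
    common hyperplane has at most [f / 2] members. Consider the density of [Y]
    among the [k]-spaces between [I] and [J]. If some member of [Y] meets [I]
    trivially and spans the whole space with [J], then the density grows by a
    factor at least [q - 1] when [I] is replaced by a suitable [I + P], or [J] by
    a suitable hyperplane of [J]. As densities are at most 1, starting from the
    most popular point or hyperplane and extending [I] and [J] in turn soon
    reaches a pair [I, J] for which every member of [Y] meets [I] or fails to
    span with [J], and then [Y] is small by a union bound.

    The classes that do have a common point or a common hyperplane amount to a
    set [M] of points and a set [Hs] of hyperplanes; let
    [#|M| + #|Hs| = q^k + q^(k-1) - r]. A [(k-1)]-space [A] that misses [M] and
    lies in [hA] of the hyperplanes is in at least [#|Hs| + r - q^(k-1) hA]
    uncovered [k]-spaces. If a [k]-space [K] contains a single point [P] of [M]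
    and is in no hyperplane of [Hs], then each of these hyperplanes cuts [K] in
    one [(k-1)]-space, so the [q^(k-1)] hyperplanes [A] of [K] off [P] have
    average [hA] at most [#|Hs| / q^(k-1)], and there are on average at least
    [r] uncovered [k]-spaces above such an [A]. As most [k]-spaces are covered at
    most once, double counting gives at least [r f / 2] uncovered [k]-spaces for
    [q >= 5]; hence there are at least [r] further colours. *)

Set Implicit Arguments.
Unset Strict Implicit.
Unset Printing Implicit Defensive.

(** * Double counting and [q]-integers *)

Section DoubleCounting.
Variable T : finType.
Implicit Types (A B : {set T}) (R : rel T).

Lemma sum_card_exchange A B R :
  \sum_(x in A) #|[set y in B | R x y]| = \sum_(y in B) #|[set x in A | R x y]|.
Proof.
transitivity (\sum_(x in A) \sum_(y in B) R x y).
  by apply: eq_bigr => x _; rewrite -sum1dep_card big_mkcondr /=;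
     apply: eq_bigr => y _; case: (R x y).
rewrite exchange_big; apply: eq_bigr => y _.
by rewrite -sum1dep_card big_mkcondr; apply: eq_bigr => x _; case: (R x y).
Qed.

End DoubleCounting.

(** The [q]-integer [(q ^ m - 1) / (q - 1)], the number of points of an [m]-space. *)
Definition qnum (q m : nat) : nat := \sum_(i < m) q ^ i.

Section QNumbers.
Variable q : nat.

Lemma qnum0 : qnum q 0 = 0.
Proof. by rewrite /qnum big_ord0. Qed.

Lemma qnum1 : qnum q 1 = 1.
Proof. by rewrite /qnum big_ord1 expn0. Qed.

Lemma qnumS m : qnum q m.+1 = q ^ m + qnum q m.
Proof. by rewrite /qnum big_ord_recr addnC. Qed.

Lemma qnum_gt0 m : 0 < m -> 0 < qnum q m.
Proof.
by case: m => // m _; rewrite /qnum big_ord_recl expn0.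
Qed.

Lemma qnumD a b : qnum q (a + b) = q ^ a * qnum q b + qnum q a.
Proof.
elim: b => [|b IH]; first by rewrite addn0 qnum0 muln0.
by rewrite addnS !qnumS IH expnD mulnDr addnA.
Qed.

Lemma qnum_double m : qnum q (2 * m) = (q ^ m + 1) * qnum q m.
Proof. by rewrite mul2n -addnn qnumD mulnDl mul1n. Qed.

Lemma qnum_exp m : 0 < q -> q.-1 * qnum q m + 1 = q ^ m.
Proof. by move=> q0; rewrite /qnum -predn_exp addn1 prednK // expn_gt0 q0. Qed.

Lemma qnum_leq a b : a <= b -> qnum q a <= qnum q b.
Proof. by move/subnKC <-; rewrite qnumD leq_addl. Qed.

Lemma qnum_ltn a b : 0 < q -> a < b -> qnum q a < qnum q b.
Proof.
move=> q0 ab; apply: leq_trans (qnum_leq ab).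
by rewrite qnumS -{1}(add0n (qnum q a)) ltn_add2r expn_gt0 q0.
Qed.

(** Source of the factor [q - 1] in each density step: [q.-1 * qnum q a] equals [q ^ a - 1]. *)
Lemma qnumM_leq a b : 0 < q -> q.-1 * (qnum q a * qnum q b) <= qnum q (a + b).
Proof.
move=> q0; rewrite mulnA qnumD -(qnum_exp a q0) mulnDl mul1n -addnA.
exact: leq_addr.
Qed.

End QNumbers.

(* The lattice of subspaces of an [n]-space over a field with [q] elements,
   axiomatised so that the dual lattice satisfies the same axioms. *)
Record geometry (q n : nat) := Geometry {
  elt :> finType;
  le : rel elt;
  meet : elt -> elt -> elt;
  join : elt -> elt -> elt;
  rk : elt -> nat;
  bot : elt;
  top : elt;
  le_refl : reflexive le;
  le_trans : transitive le;
  le_meet : forall x y z, le x (meet y z) = le x y && le x z;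
  le_join : forall x y z, le (join x y) z = le x z && le y z;
  le_rk : forall x y, le x y -> rk x <= rk y;
  le_eq : forall x y, le x y -> rk y <= rk x -> x = y;
  rk_modular : forall x y, rk (meet x y) + rk (join x y) = rk x + rk y;
  le_bot : forall x, le bot x;
  le_top : forall x, le x top;
  rk_bot : rk bot = 0;
  rk_top : rk top = n;
  card_atoms : forall x y, le x y ->
    #|[set z | [&& le x z, le z y & rk z == (rk x).+1]]| = qnum q (rk y - rk x);
  card_coatoms : forall x y, le x y ->
    #|[set z | [&& le x z, le z y & (rk z).+1 == rk y]]| = qnum q (rk y - rk x)
}.

Notation "x [<=] y" := (le x y) (at level 70, no associativity).
Notation "x [/\] y" := (meet x y) (at level 40, left associativity).
Notation "x [\/] y" := (join x y) (at level 50, left associativity).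

(** * Duality and counting in intervals *)

Section Dual.
Variables (q n : nat) (G : geometry q n).

Lemma rk_le_top (x : G) : rk x <= n.
Proof. by have := le_rk (le_top x); rewrite rk_top. Qed.

(** The carrier is unchanged, so a set of elements of [G] is also one of [dual G]. It is transparent
    so that the dual order and rank reduce by conversion. *)
Definition dual : geometry q n.
Proof.
refine (@Geometry q n (elt G) (fun x y => y [<=] x) (@join _ _ G) (@meet _ _ G)
  (fun x => n - rk x) (top G) (bot G) _ _ _ _ _ _ _ _ _ _ _ _ _).
- exact: le_refl.
- by move=> y x z xy yz; apply: le_trans yz xy.
- by move=> x y z; rewrite le_join.
- by move=> x y z; rewrite le_meet.
- by move=> x y /le_rk; lia.
- move=> x y yx; have := rk_le_top x; have := rk_le_top y => ? ? h.
  by symmetry; apply: le_eq => //; lia.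
- move=> x y; have := rk_modular x y.
  have := rk_le_top (x [/\] y).
  by have := rk_le_top (x [\/] y); have := rk_le_top x; have := rk_le_top y; lia.
- exact: le_top.
- exact: le_bot.
- by rewrite rk_top subnn.
- by rewrite rk_bot subn0.
- move=> x y yx; have hx := rk_le_top x; have hyx := le_rk yx.
  rewrite (_ : n - rk y - (n - rk x) = rk x - rk y); last by lia.
  rewrite -(card_coatoms yx); apply: eq_card => z; rewrite !inE.
  have hz := rk_le_top z.
  case: (boolP (z [<=] x)) => [/le_rk zx|]; last by rewrite !andbF.
  by case: (boolP (y [<=] z)) => //= _; lia.
- move=> x y yx; have hx := rk_le_top x; have hyx := le_rk yx.
  rewrite (_ : n - rk y - (n - rk x) = rk x - rk y); last by lia.
  rewrite -(card_atoms yx); apply: eq_card => z; rewrite !inE.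
  have hz := rk_le_top z.
  case: (boolP (z [<=] x)) => [/le_rk zx|]; last by rewrite !andbF.
  by case: (boolP (y [<=] z)) => //= _; lia.
Defined.

End Dual.

(* The Gaussian binomial coefficient: the recursion is exact division
   whenever it is used to count an interval of a geometry. *)
Fixpoint gauss (q m e : nat) : nat :=
  if e is e'.+1 then (qnum q m * gauss q m.-1 e') %/ qnum q e else 1.

Section Intervals.
Variables (q n : nat) (G : geometry q n).
Implicit Types x y z : G.

Definition itv x y d := [set z : G | [&& x [<=] z, z [<=] y & rk z == d]].

Lemma meet_lel x y : x [/\] y [<=] x.
Proof. by have := le_refl (x [/\] y); rewrite le_meet => /andP[]. Qed.

Lemma meet_ler x y : x [/\] y [<=] y.
Proof. by have := le_refl (x [/\] y); rewrite le_meet => /andP[]. Qed.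

Lemma join_gel x y : x [<=] x [\/] y.
Proof. by have := le_refl (x [\/] y); rewrite le_join => /andP[]. Qed.

Lemma join_ger x y : y [<=] x [\/] y.
Proof. by have := le_refl (x [\/] y); rewrite le_join => /andP[]. Qed.

Lemma le_anti x y : x [<=] y -> y [<=] x -> x = y.
Proof. by move=> xy yx; apply: le_eq => //; apply: le_rk. Qed.

Lemma card_itv_atom x y d : x [<=] y -> (rk x).+1 = d ->
  #|itv x y d| = qnum q (rk y - rk x).
Proof. by move=> xy <-; apply: card_atoms. Qed.

Lemma card_points x : #|itv (bot G) x 1| = qnum q (rk x).
Proof. by rewrite card_itv_atom ?le_bot ?rk_bot ?subn0. Qed.

Lemma card_itv_coatom x y d : x [<=] y -> rk y = d.+1 ->
  #|itv x y d| = qnum q (rk y - rk x).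
Proof.
by move=> xy yd; rewrite -(card_coatoms xy); apply: eq_card => z; rewrite !inE yd eqSS.
Qed.

Lemma itv_rkE x y d z : z \in itv x y d -> rk z = d.
Proof. by rewrite inE => /and3P[_ _ /eqP]. Qed.

Lemma itv_gel x y d z : z \in itv x y d -> x [<=] z.
Proof. by rewrite inE => /and3P[]. Qed.

Lemma itv_ger x y d z : z \in itv x y d -> z [<=] y.
Proof. by rewrite inE => /and3P[]. Qed.

(** Counts pairs of an atom [a] above [x] and a [z] of rank [d] between [a] and [y]. *)
Lemma card_itv_up x y d N : x [<=] y -> rk x < d ->
  (forall a, a \in itv x y (rk x).+1 -> #|itv a y d| = N) ->
  #|itv x y d| * qnum q (d - rk x) = qnum q (rk y - rk x) * N.
Proof.
move=> xy xd H.
have := sum_card_exchange (itv x y (rk x).+1) (itv x y d) (@le _ _ G).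
rewrite (eq_bigr (fun=> N)); last first.
  move=> a aI; rewrite -(H a aI); apply: eq_card => z; rewrite !inE.
  have xa := itv_gel aI.
  case: (boolP (a [<=] z)) => [az|]; last by rewrite andbF.
  by rewrite (le_trans xa az) /= andbT.
rewrite sum_nat_const card_itv_atom // => ->.
rewrite (eq_bigr (fun=> qnum q (d - rk x))) ?sum_nat_const //.
move=> z zI; rewrite -(itv_rkE zI) -(card_itv_atom (itv_gel zI) erefl).
apply: eq_card => a; rewrite !inE -!andbA.
case: (boolP (x [<=] a)) => //= xa.
case: (boolP (a [<=] z)) => [az|]; last by rewrite !andbF.
by rewrite (le_trans az (itv_ger zI)) andbT.
Qed.

Lemma card_itv_down x y d N m : x [<=] y -> d < rk y -> rk y = m.+1 ->
  (forall a, a \in itv x y m -> #|itv x a d| = N) ->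
  #|itv x y d| * qnum q (rk y - d) = qnum q (rk y - rk x) * N.
Proof.
move=> xy yd ym H.
have := sum_card_exchange (itv x y d) (itv x y m) (@le _ _ G).
rewrite (eq_bigr (fun=> qnum q (rk y - d))); last first.
  move=> z zI; rewrite -(itv_rkE zI) -(card_itv_coatom (itv_ger zI) ym).
  apply: eq_card => a; rewrite !inE -!andbA.
  case: (boolP (z [<=] a)) => [za|]; last by rewrite !andbF.
  by rewrite (le_trans (itv_gel zI) za) andbT.
rewrite sum_nat_const => ->.
rewrite -(card_itv_coatom xy ym) -sum_nat_const; apply: eq_bigr => a aI.
rewrite -(H a aI); apply: eq_card => z; rewrite !inE.
case: (boolP (z [<=] a)) => [za|]; last by rewrite !andbF.
by rewrite (le_trans za (itv_ger aI)) andbT.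
Qed.

(** Induction on [d - rk x] through the atoms above [x]; [card_itv_up] shows that the division in
    [gauss] is exact. *)
Lemma card_itv x y d : x [<=] y -> rk x <= d ->
  #|itv x y d| = gauss q (rk y - rk x) (d - rk x).
Proof.
move=> xy /subnKC; move: (d - rk x) => e E.
elim: e x E xy => [|e IH] x E xy.
  rewrite -E addn0 /= -(cards1 x); apply: eq_card => z; rewrite !inE.
  apply/and3P/eqP => [[xz _ /eqP h]|->]; last by rewrite le_refl.
  by symmetry; apply: le_eq; rewrite ?h.
have H a : a \in itv x y (rk x).+1 -> #|itv a y d| = gauss q (rk y - rk x).-1 e.
  move=> aI; have ra := itv_rkE aI.
  by rewrite IH ?(itv_ger aI) ?ra ?subnS // -E addSnnS.
have xd : rk x < d by lia.
have := card_itv_up xy xd H; rewrite (_ : d - rk x = e.+1); last by lia.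
by move=> /= <-; rewrite mulnK // qnum_gt0.
Qed.

Lemma join_atom x y p : x [<=] y -> rk y = (rk x).+1 -> p [<=] y -> ~~ (p [<=] x) ->
  x [\/] p = y.
Proof.
move=> xy ry py px; apply: le_eq; first by rewrite le_join xy py.
rewrite ry ltnNge; apply: contra px => le_x.
by rewrite (le_eq (join_gel x p) le_x) join_ger.
Qed.

Lemma exists_atom x y : x [<=] y -> rk x < rk y ->
  exists a, a \in itv x y (rk x).+1.
Proof.
move=> xy r; case: (set_0Vmem (itv x y (rk x).+1)) => [E|[a aI]]; last by exists a.
have := card_itv_atom xy erefl; rewrite E cards0.
by have := @qnum_gt0 q (rk y - rk x); lia.
Qed.

Lemma exists_rk x d : rk x <= d <= n -> exists2 y, x [<=] y & rk y = d.
Proof.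
case/andP=> /subnKC <-; elim: (d - rk x) => [|e IH] en.
  by exists x; rewrite ?le_refl ?addn0.
have [y xy ry] := IH ltac:(lia).
have [a aI] : exists a, a \in itv y (top G) (rk y).+1.
  by apply: exists_atom; rewrite ?le_top // rk_top; lia.
exists a; first exact: le_trans xy (itv_gel aI).
by rewrite (itv_rkE aI) ry addnS.
Qed.

Lemma point_notin x y : 0 < q -> ~~ (x [<=] y) ->
  exists p, [/\ rk p = 1, p [<=] x & ~~ (p [<=] y)].
Proof.
move=> q0 xy.
have sub : itv (bot G) (x [/\] y) 1 \subset itv (bot G) x 1.
  by apply/subsetP=> z; rewrite !inE le_meet => /and3P[-> /andP[-> _] ->].
have lt : rk (x [/\] y) < rk x.
  rewrite ltnNge; apply: contra xy => h.
  by rewrite -(le_eq (meet_lel x y) h) meet_ler.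
have : itv (bot G) (x [/\] y) 1 \proper itv (bot G) x 1.
  by rewrite properEcard sub !card_points qnum_ltn.
case/properP=> _ [p pI pN]; exists p; split; first exact: itv_rkE pI.
  exact: itv_ger pI.
apply: contra pN => py; move: pI; rewrite !inE le_meet py andbT => /and3P[-> -> ->].
by [].
Qed.

End Intervals.

(** * Families of points and hyperplanes covering the middle layer *)

Section MiddleLayer.
Variables (q k : nat) (G : geometry q (2 * k.+1)).
Hypothesis q_gt0 : 0 < q.
Implicit Types x y z p h K A : G.

(** The number [f] of the overview. The middle rank is written [k.+1] here, so [k] is one less than
    in the overview. *)
Definition nspaces : nat := gauss q (2 * k).+1 k.

Definition point x := rk x == 1.
Definition hyperplane x := rk x == (2 * k).+1.

Lemma exists_point x : 0 < rk x -> exists2 p, point p & p [<=] x.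
Proof.
move=> x0; have xb : ~~ (x [<=] bot G).
  by apply: contraL x0 => /le_rk; rewrite rk_bot; lia.
by have [p [p1 px _]] := point_notin q_gt0 xb; exists p => //; apply/eqP.
Qed.

Lemma card_on_point p : point p -> #|itv p (top G) k.+1| = nspaces.
Proof.
move=> /eqP p1; rewrite card_itv ?le_top ?p1 // rk_top subSS subn0.
by rewrite (_ : 2 * k.+1 - 1 = (2 * k).+1) //; lia.
Qed.

Lemma card_layer : #|itv (bot G) (top G) k.+1| = (q ^ k.+1 + 1) * nspaces.
Proof.
have := @card_itv_up _ _ G (bot G) (top G) k.+1 nspaces (le_bot _).
rewrite rk_bot rk_top !subn0 qnum_double => H.
have {}H := H isT (fun a aI => card_on_point (introT eqP (itv_rkE aI))).
apply/eqP; rewrite -(eqn_pmul2r (@qnum_gt0 q k.+1 isT)) H.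
by rewrite mulnAC eqxx.
Qed.

(** All hyperplanes contain equally many elements of the middle layer; counting the layer through
    hyperplanes and comparing with [card_layer] identifies this number. *)
Lemma card_in_hyperplane h : hyperplane h -> #|itv (bot G) h k.+1| = nspaces.
Proof.
move=> /eqP h1.
have cE a : rk a = (2 * k).+1 -> #|itv (bot G) a k.+1| = gauss q (2 * k).+1 k.+1.
  by move=> ra; rewrite card_itv ?le_bot ?rk_bot // ra !subn0.
rewrite cE //.
have := @card_itv_down _ _ G (bot G) (top G) k.+1 (gauss q (2 * k).+1 k.+1) (2 * k).+1 (le_bot _).
rewrite rk_top rk_bot card_layer => H.
have {}H : (q ^ k.+1 + 1) * nspaces * qnum q (2 * k.+1 - k.+1) =
    qnum q (2 * k.+1 - 0) * gauss q (2 * k).+1 k.+1.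
  by apply: H; [lia | lia | move=> a aI; apply: cE; apply: itv_rkE aI].
move: H; rewrite subn0 qnum_double (_ : 2 * k.+1 - k.+1 = k.+1); last by lia.
rewrite mulnAC => /eqP; rewrite eqn_pmul2l; first by move/eqP.
by rewrite muln_gt0 addn1 /= qnum_gt0.
Qed.

Lemma nspaces_gt0 : 0 < nspaces.
Proof.
have := card_layer; case: (posnP nspaces) => // ->; rewrite muln0 => /cards0_eq E.
have [K _ rK] : exists2 K, bot G [<=] K & rk K = k.+1.
  by apply: exists_rk; rewrite rk_bot; lia.
have : K \in itv (bot G) (top G) k.+1 by rewrite inE le_bot le_top rK eqxx.
by rewrite E inE.
Qed.

Section Cover.
Variables (M Hs : {set G}).
Hypothesis M_pt : {in M, forall p, point p}.
Hypothesis Hs_hyp : {in Hs, forall h, hyperplane h}.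

Definition uncovered := [set K : G | [&& rk K == k.+1,
  #|[set p in M | p [<=] K]| == 0 & #|[set h in Hs | K [<=] h]| == 0]].

Definition point_covered_once := [set K : G | [&& rk K == k.+1,
  #|[set p in M | p [<=] K]| == 1 & #|[set h in Hs | K [<=] h]| == 0]].

(* The union is largest when the hyperplanes share a corank 2 element above [A];
   the first one then contributes [qnum q k.+1] elements, each other [q ^ k]. *)
Lemma card_hyperplane_union A (S : {set G}) : rk A = k ->
    {in S, forall h, hyperplane h && (A [<=] h)} ->
  #|[set K in itv A (top G) k.+1 | [exists h in S, K [<=] h]]|
    <= q ^ k * #|S| + qnum q k.
Proof.
move=> rA; have [m] := ubnP #|S|; elim: m S => // m IH S Sm SH.
have cI h : hyperplane h -> A [<=] h -> #|itv A h k.+1| = q ^ k + qnum q k.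
  move=> /eqP rh Ah; rewrite card_itv_atom ?rA // rh -qnumS; congr qnum; lia.
case: (set_0Vmem S) => [->|[h hS]].
  rewrite (_ : [set _ in _ | _] = set0) ?cards0 //.
  apply/setP=> K; rewrite !inE; apply/negP=> /andP[_ /existsP[h]]; by rewrite inE.
have /andP[hh Ah] := SH h hS.
case: (set_0Vmem (S :\ h)) => [E|[g gS]].
  rewrite (cardsD1 h S) hS E cards0 addn0 muln1 -(cI h) //; apply: subset_leq_card.
  apply/subsetP=> K; rewrite !inE => /andP[/and3P[-> _ ->] /existsP[g /andP[gS Kg]]].
  suff -> : h = g by rewrite Kg.
  by apply/eqP; have := in_set0 g; rewrite -E !inE gS andbT eq_sym => /negbFE.
have [gh gS'] : g != h /\ g \in S by move: gS; rewrite !inE => /andP.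
have /andP[hg Ag] := SH g gS'.
have rm : rk (h [/\] g) = 2 * k.
  have := rk_modular h g; rewrite (eqP hh) (eqP hg).
  suff : rk (h [\/] g) = 2 * k.+1 by lia.
  apply/eqP; rewrite eqn_leq rk_le_top leqNgt; apply: contra gh => lt_n.
  have e1 : h = h [\/] g by apply: le_eq (join_gel _ _) _; rewrite (eqP hh); lia.
  apply/eqP; apply: le_eq; first by rewrite e1 join_ger.
  by rewrite (eqP hh) (eqP hg).
have Am : A [<=] h [/\] g by rewrite le_meet Ah Ag.
have := IH (S :\ h); rewrite (cardsD1 h S) hS add1n => /(_ _ _).
have -> : #|S :\ h| < m by move: Sm; rewrite (cardsD1 h S) hS.
move=> /(_ isT) {}IH.
have {}IH := IH (fun g gS => SH g (subsetP (subsetDl _ _) g gS)).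
set W := [set _ in _ | _] in IH *.
have -> : q ^ k * #|S :\ h|.+1 + qnum q k = q ^ k * #|S :\ h| + qnum q k + q ^ k.
  by rewrite mulnS; lia.
(* Elements below both [h] and [g] are already in the union over [S :\ h], so [h] adds at most
   [qnum q k.+1 - qnum q k = q ^ k]. *)
apply: leq_trans (leq_add IH _); last first.
  suff : #|itv A h k.+1 :\: itv A (h [/\] g) k.+1| <= q ^ k by apply.
  rewrite cardsD (setIidPr _); last first.
    apply/subsetP=> K; rewrite !inE le_meet => /and3P[-> /andP[-> _] ->] //.
  by rewrite cI // card_itv_atom ?rA // rm mul2n -addnn !addnK.
apply: leq_trans (leq_card_setU _ _); apply: subset_leq_card.
apply/subsetP=> K; rewrite !inE le_meet => /andP[/and3P[AK -> rK]].
rewrite AK rK /= !andbT => /existsP[x /andP[xS Kx]].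
case: (eqVneq x h) => [xh|xh].
  have Kh : K [<=] h by rewrite -xh.
  rewrite Kh /=; case: (boolP (K [<=] g)) => Kg; last by rewrite orbT.
  by apply/orP; left; apply/existsP; exists g; rewrite !inE gh gS' Kg.
by apply/orP; left; apply/existsP; exists x; rewrite !inE xh xS Kx.
Qed.

(** Of the [qnum q k.+2] elements above [A], a point [p] of [M] spoils only [A [\/] p]. The term
    [qnum q k] in the bound for the hyperplanes cancels against the same term of [qnum q k.+2]. *)
Lemma card_uncovered_above A : rk A = k -> #|[set p in M | p [<=] A]| = 0 ->
  q ^ k.+1 + q ^ k <= #|[set K in uncovered | A [<=] K]| + #|M|
    + q ^ k * #|[set h in Hs | A [<=] h]|.
Proof.
move=> rA A0; set S := [set h in Hs | _].
have SH : {in S, forall h, hyperplane h && (A [<=] h)}.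
  by move=> h; rewrite inE => /andP[/Hs_hyp -> ->].
have := card_hyperplane_union rA SH; set W := [set K in _ | _] => cW.
have cT : #|itv A (top G) k.+1| = q ^ k.+1 + q ^ k + qnum q k.
  rewrite card_itv_atom ?le_top ?rA // rk_top (_ : 2 * k.+1 - k = k.+2); last by lia.
  by rewrite !qnumS addnA.
suff : #|itv A (top G) k.+1| <= #|[set K in uncovered | A [<=] K]| + #|M| + #|W|.
  by rewrite cT; lia.
apply: leq_trans (_ : #|[set K in uncovered | A [<=] K] :|: join A @: M :|: W| <= _).
  apply: subset_leq_card; apply/subsetP=> K KI; rewrite !in_setU.
  have AK := itv_gel KI; have rK := itv_rkE KI.
  case: (boolP (K \in W)) => KW; rewrite ?orbT // orbF.
  case: (posnP #|[set p in M | p [<=] K]|) => [K0|]; last first.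
    case/card_gt0P=> p; rewrite inE => /andP[pM pK]; apply/orP; right.
    apply/imsetP; exists p => //; rewrite (join_atom AK) ?rK ?rA //.
    by apply/negP=> pA; have := in_set0 p; rewrite -(cards0_eq A0) inE pM pA.
  apply/orP; left; rewrite !inE rK eqxx K0 AK /= !andbT cards_eq0.
  apply/eqP/setP=> h; rewrite !inE; apply/negP=> /andP[hH Kh].
  move/negP: KW; apply; rewrite inE KI; apply/existsP; exists h.
  by rewrite inE hH (le_trans AK Kh).
apply: leq_trans (leq_card_setU _ _) _; rewrite leq_add2r.
apply: leq_trans (leq_card_setU _ _) _; rewrite leq_add2l.
exact: leq_imset_card.
Qed.

Definition missing K := [set A in itv (bot G) K k | #|[set p in M | p [<=] A]| == 0].

Variable r : nat.
Hypothesis card_cover : #|M| + #|Hs| + r = q ^ k.+1 + q ^ k.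

(* Every hyperplane of [Hs] cuts [K] in a single rank [k] element, so the
   average number of hyperplanes above an element of [missing K] is at most
   [#|Hs| / q ^ k]. *)
Lemma sum_uncovered_below K : K \in point_covered_once ->
  q ^ k * r <= \sum_(A in missing K) #|[set L in uncovered | A [<=] L]|.
Proof.
rewrite inE => /and3P[/eqP rK /cards1P[p pE] /eqP Hs0].
have [pM pK] : p \in M /\ p [<=] K.
  by apply/andP; have := set11 p; rewrite -pE inE.
have rp := eqP (M_pt pM).
(* As [p] is the only point of [M] in [K], avoiding [M] means avoiding [p]. *)
have mE : missing K = itv (bot G) K k :\: itv p K k.
  apply/setP=> A; rewrite !inE andbC; case: (boolP (A [<=] K)); last by rewrite !andbF.
  move=> AK; rewrite le_bot /=; case: (rk A == k); rewrite ?andbF ?andbT //=.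
  rewrite cards_eq0; apply/eqP/idP => [E|pA].
    by apply/negP=> pA; have := in_set0 p; rewrite -E inE pM pA.
  apply/setP=> p'; rewrite !inE; apply/negP=> /andP[p'M p'A].
  suff p'E : p' = p by rewrite -p'E p'A in pA.
  by apply/set1P; rewrite -pE inE p'M (le_trans p'A AK).
have cm : #|missing K| = q ^ k.
  rewrite mE cardsD (setIidPr _); last first.
    by apply/subsetP=> A; rewrite !inE le_bot => /and3P[_ -> ->].
  rewrite !(card_itv_coatom _ rK) ?le_bot // rK rk_bot rp subn0 subSS subn0.
  by rewrite qnumS addnK.
have sh : \sum_(A in missing K) #|[set h in Hs | A [<=] h]| <= #|Hs|.
  rewrite (sum_card_exchange _ _ (@le _ _ G)) -sum1_card; apply: leq_sum => h hH.
  have Kh : ~~ (K [<=] h).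
    apply/negP=> Kh; have := in_set0 h.
    by rewrite -(cards0_eq Hs0) inE hH Kh.
  apply: leq_trans (_ : #|[set K [/\] h]| <= 1); last by rewrite cards1.
  apply: subset_leq_card; apply/subsetP=> A; rewrite !inE.
  case/andP=> /andP[/and3P[_ AK /eqP rA] _] Ah; apply/eqP; apply: le_eq.
    by rewrite le_meet AK Ah.
  rewrite rA; suff : rk (K [/\] h) < rk K by rewrite rK.
  rewrite ltnNge; apply: contra Kh => le_K.
  by rewrite -(le_eq (meet_lel K h) le_K) meet_ler.
have : \sum_(A in missing K) (#|Hs| + r) <= \sum_(A in missing K)
    (#|[set L in uncovered | A [<=] L]| + q ^ k * #|[set h in Hs | A [<=] h]|).
  apply: leq_sum => A; rewrite inE => /andP[/itv_rkE rA /eqP A0].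
  by have := card_uncovered_above rA A0; lia.
rewrite sum_nat_const cm big_split /= -big_distrr /= mulnDr.
by have := leq_mul (leqnn (q ^ k)) sh; lia.
Qed.

(** Counts triples of a once covered [K], an uncovered [L] and a common [A] of rank [k] off [M].
    Each [A] is below at most [#|M|] such [K], all of the form [A [\/] p], and each [L] has
    [qnum q k.+1] candidates for [A]. *)
Lemma point_covered_once_bound :
  r * #|point_covered_once| * q ^ k <= #|uncovered| * qnum q k.+1 * #|M|.
Proof.
set X := point_covered_once.
pose As := [set A : G | (rk A == k) && (#|[set p in M | p [<=] A]| == 0)].
pose u A := #|[set L in uncovered | A [<=] L]|.
have mE K : missing K = [set A in As | A [<=] K].
  by apply/setP=> A; rewrite !inE le_bot /=; case: (A [<=] K); rewrite ?andbF ?andbT.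
have lo : #|X| * (q ^ k * r) <= \sum_(K in X) \sum_(A in missing K) u A.
  by rewrite -sum_nat_const; apply: leq_sum => K /sum_uncovered_below.
have ex : \sum_(K in X) \sum_(A in missing K) u A =
    \sum_(A in As) #|[set K in X | A [<=] K]| * u A.
  rewrite (exchange_big_dep (mem As)) /=; last first.
    by move=> K A _; rewrite mE inE => /andP[].
  apply: eq_bigr => A AA; rewrite -sum_nat_cond_const; apply: eq_bigl => K.
  by rewrite mE [A \in _]in_set AA.
have cX A : A \in As -> #|[set K in X | A [<=] K]| <= #|M|.
  rewrite inE => /andP[/eqP rA /eqP A0].
  apply: leq_trans (leq_imset_card (join A) M); apply: subset_leq_card.
  apply/subsetP=> K; rewrite !inE => /andP[/and3P[/eqP rK /cards1P[p pE] _] AK].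
  have /andP[pM pK] : (p \in M) && (p [<=] K) by have := set11 p; rewrite -pE inE.
  apply/imsetP; exists p => //; rewrite (join_atom AK) ?rK ?rA //.
  by apply/negP=> pA; have := in_set0 p; rewrite -(cards0_eq A0) inE pM pA.
have hi : \sum_(A in As) u A <= #|uncovered| * qnum q k.+1.
  rewrite (sum_card_exchange _ _ (@le _ _ G)) -sum_nat_const; apply: leq_sum => L.
  rewrite inE => /and3P[/eqP rL _ _].
  have <- : #|itv (bot G) L k| = qnum q k.+1.
    by rewrite (card_itv_coatom (le_bot _) rL) rL rk_bot.
  apply: subset_leq_card; apply/subsetP=> A; rewrite !inE le_bot.
  by case/andP=> /andP[-> _] ->.
rewrite mulnC mulnA [_ * #|X|]mulnC.
apply: leq_trans lo _; rewrite ex.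
apply: leq_trans (_ : \sum_(A in As) #|M| * u A <= _).
  by apply: leq_sum => A /cX ?; rewrite leq_mul2r orbC; apply/orP; left.
by rewrite -big_distrr /= [leqRHS]mulnC leq_mul2l hi orbT.
Qed.

End Cover.
End MiddleLayer.

(** * Combining points and hyperplanes by duality *)

Section CoverBound.
Variables (q k : nat) (G : geometry q (2 * k.+1)).
Implicit Types (p h K : G) (M Hs : {set G}).

Lemma dual_middle (x : G) : (2 * k.+1 - rk x == k.+1) = (rk x == k.+1).
Proof. by have := rk_le_top x; lia. Qed.

Lemma dual_point (x : G) : @point q k (dual G) x = hyperplane x.
Proof. by rewrite /point /hyperplane /=; have := rk_le_top x; lia. Qed.

Lemma dual_hyperplane (x : G) : @hyperplane q k (dual G) x = point x.
Proof. by rewrite /point /hyperplane /=; have := rk_le_top x; lia. Qed.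

Definition hyperplane_covered_once M Hs := [set K : G | [&& rk K == k.+1,
  #|[set p in M | p [<=] K]| == 0 & #|[set h in Hs | K [<=] h]| == 1]].

Lemma dual_uncovered M Hs :
  #|@uncovered q k (dual G) Hs M| = #|uncovered M Hs|.
Proof.
apply: eq_card => K; rewrite !inE /= dual_middle; congr (_ && _); exact: andbC.
Qed.

Lemma dual_point_covered_once M Hs :
  #|@point_covered_once q k (dual G) Hs M| = #|hyperplane_covered_once M Hs|.
Proof.
apply: eq_card => K; rewrite !inE /= dual_middle; congr (_ && _); exact: andbC.
Qed.

Lemma sum_mem_subset (A S : {set G}) : S \subset A ->
  \sum_(K in A) (K \in S : nat) = #|S|.
Proof.
move=> SA; rewrite -sum1_card [RHS]big_mkcond [LHS]big_mkcond /=.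
apply: eq_bigr => K _; case: (boolP (K \in S)) => [/(subsetP SA) ->|] //.
by case: ifP.
Qed.

(* Summed over the rank [k.+1] elements [K], with [x] the number of members of
   [M] and [Hs] incident with [K], this is [2 <= 2 * [x = 0] + x + [x = 1]]. *)
Lemma cover_overlap M Hs : 0 < q ->
    {in M, forall p, point p} -> {in Hs, forall h, hyperplane h} ->
  2 * ((q ^ k.+1 + 1) * nspaces q k) <= 2 * #|uncovered M Hs|
    + (#|M| + #|Hs|) * nspaces q k
    + (#|point_covered_once M Hs| + #|hyperplane_covered_once M Hs|).
Proof.
move=> q0 MP HH; set L := itv (bot G) (top G) k.+1.
have memL K : (K \in L) = (rk K == k.+1) by rewrite inE le_bot le_top.
have sM : \sum_(K in L) #|[set p in M | p [<=] K]| = #|M| * nspaces q k.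
  rewrite (sum_card_exchange _ _ (fun K p => p [<=] K)) -sum_nat_const.
  apply: eq_bigr => p /MP pp; rewrite -(card_on_point q0 pp); apply: eq_card => K.
  by rewrite !inE le_bot le_top andbC.
have sH : \sum_(K in L) #|[set h in Hs | K [<=] h]| = #|Hs| * nspaces q k.
  rewrite (sum_card_exchange _ _ (@le _ _ G)) -sum_nat_const.
  apply: eq_bigr => h /HH hh; rewrite -(card_in_hyperplane q0 hh); apply: eq_card => K.
  by rewrite !inE le_bot le_top andbC.
have sU : \sum_(K in L) (K \in uncovered M Hs : nat) = #|uncovered M Hs|.
  by apply: sum_mem_subset; apply/subsetP=> K; rewrite memL !inE => /andP[].
have sX : \sum_(K in L) (K \in point_covered_once M Hs : nat) = #|point_covered_once M Hs|.
  by apply: sum_mem_subset; apply/subsetP=> K; rewrite memL !inE => /andP[].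
have sY : \sum_(K in L) (K \in hyperplane_covered_once M Hs : nat)
    = #|hyperplane_covered_once M Hs|.
  by apply: sum_mem_subset; apply/subsetP=> K; rewrite memL !inE => /andP[].
rewrite -(card_layer G q0) mulnC -sum_nat_const mulnDl -sM -sH -sU -sX -sY.
rewrite big_distrr -!big_split /=; apply: leq_sum => K; rewrite memL => rK.
rewrite !inE rK /=; move: #|_| #|_| => a b.
by case: a => [|[|a]]; case: b => [|[|b]] //=; lia.
Qed.

(** If there were fewer uncovered elements, [cover_overlap] would force more than
    [f * (q - 1) * q ^ k] elements covered once, contradicting the sum of [point_covered_once_bound]
    and its dual. *)
Lemma cover_bound M Hs r : 4 < q ->
    {in M, forall p, point p} -> {in Hs, forall h, hyperplane h} ->
    #|M| + #|Hs| + r = q ^ k.+1 + q ^ k ->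
  nspaces q k * r <= 2 * #|uncovered M Hs|.
Proof.
move=> q4 MP HH mhr; have q0 : 0 < q by lia.
have ov := cover_overlap q0 MP HH.
have bM := point_covered_once_bound q0 MP HH mhr.
have bH : r * #|hyperplane_covered_once M Hs| * q ^ k
    <= #|uncovered M Hs| * qnum q k.+1 * #|Hs|.
  rewrite -dual_point_covered_once -dual_uncovered.
  apply: point_covered_once_bound => //.
  - by move=> h /HH; rewrite dual_point.
  - by move=> p /MP; rewrite dual_hyperplane.
  - by rewrite -mhr [in RHS](addnC #|M|).
have := qnum_exp k.+1 q0; rewrite expnS.
move: ov bM bH mhr; rewrite expnS.
move: #|uncovered _ _| #|point_covered_once _ _| #|hyperplane_covered_once _ _|.
move: #|M| #|Hs| (nspaces q k) (qnum q k.+1) => m h f N1 U X Y.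
have : 0 < q ^ k by rewrite expn_gt0 q0.
move: (q ^ k) => Q Q0 ov bM bH mhr qE.
rewrite leqNgt; apply/negP=> Ufr.
have XY : f * (q.-1 * Q) < X + Y by nia.
have mh : m + h <= (q + 1) * Q by lia.
have s1 : r * (X + Y) * Q <= U * N1 * ((q + 1) * Q).
  apply: leq_trans (leq_mul (leqnn _) mh).
  by rewrite !mulnDr mulnDl leq_add.
have r0 : 0 < r by case: (posnP r) Ufr => // ->; rewrite muln0.
have s2 : r * (f * (q.-1 * Q)) < U * N1 * (q + 1).
  apply: leq_trans (_ : r * (X + Y) <= _); first by rewrite ltn_mul2l r0.
  by rewrite -(leq_pmul2r Q0) -[leqRHS]mulnA.
have s3 : r * f * (q.-1 * q.-1) * Q < U * q * (q + 1) * Q.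
  apply: leq_trans (_ : q.-1 * (U * N1 * (q + 1)) <= _).
    rewrite (_ : r * f * (q.-1 * q.-1) * Q = q.-1 * (r * (f * (q.-1 * Q)))); last by ring.
    by rewrite ltn_mul2l s2 andbT; lia.
  rewrite (_ : q.-1 * (U * N1 * (q + 1)) = (q.-1 * N1) * (U * (q + 1))); last by ring.
  rewrite (_ : U * q * (q + 1) * Q = (q * Q) * (U * (q + 1))); last by ring.
  by rewrite leq_mul2r -qE leq_addr orbT.
(* For [q = 5] this reads [30 <= 32]; for [q = 4] it fails. *)
have s4 : q * (q + 1) <= 2 * (q.-1 * q.-1) by nia.
have {}s3 : r * f * (q.-1 * q.-1) < U * (q * (q + 1)).
  by move: s3; rewrite ltn_mul2r -[U * q * _]mulnA => /andP[].
have s5 : 2 * U * (q.-1 * q.-1) <= f * r * (q.-1 * q.-1).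
  by rewrite leq_mul2r (ltnW Ufr) orbT.
have s6 : U * (q * (q + 1)) <= U * (2 * (q.-1 * q.-1)) by rewrite leq_mul2l s4 orbT.
move: s3; rewrite ltnNge => /negP; apply.
apply: leq_trans s6 _; rewrite mulnA (mulnC U) (mulnC r); exact: s5.
Qed.

End CoverBound.

(** * Intersecting families *)

Section Between.
Variables (q k : nat) (G : geometry q (2 * k.+1)).
Variable Y : {set G}.
Implicit Types x y z p h K I J : G.

Definition between I J := [set K in Y | (I [<=] K) && (K [<=] J)].

Definition intersecting :=
  {in Y, forall K, rk K = k.+1} /\ {in Y &, forall K L, 0 < rk (K [/\] L)}.

(* [Y] has positive density at least [a * q.-1 ^ s / nspaces] in the interval
   from [I] to [J]. *)
Definition dense a s I J := (0 < #|between I J|) &&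
  (a * q.-1 ^ s * #|itv I J k.+1| <= #|between I J| * nspaces q k).

Definition stops I J :=
  [forall K in Y, (0 < rk (K [/\] I)) || (rk (K [\/] J) < 2 * k.+1)].

Hypothesis Yint : intersecting.
Hypothesis q_gt1 : 1 < q.

Let q_gt0 : 0 < q. Proof. exact: ltnW. Qed.

(* Every member of [Y] in the interval meets the witness [K0] of the failure of
   [stops] in a point of [K0 [/\] J]; take the most popular such point. *)
Lemma extend_up_card I J : I [<=] J -> 0 < #|between I J| -> ~~ stops I J ->
  exists I', [/\ I [<=] I', I' [<=] J, rk I' = (rk I).+1
    & #|between I J| <= qnum q (rk J - k.+1) * #|between I' J|].
Proof.
case: Yint => rY iY IJ /card_gt0P[K1 K1B] /forallPn[K0].
rewrite negb_imply negb_or -leqNgt leqn0 -leqNgt => /and3P[K0Y /eqP K0I K0J].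
set S := itv (bot G) (K0 [/\] J) 1.
have rS : rk (K0 [/\] J) = rk J - k.+1.
  have := rk_modular K0 J; rewrite (rY _ K0Y).
  (* [K0] spans the whole space with [J], which determines the rank of [K0 [/\] J]. *)
  have -> : rk (K0 [\/] J) = 2 * k.+1 by apply/eqP; rewrite eqn_leq rk_le_top.
  by lia.
have hit K : K \in between I J -> exists2 p, p \in S & p [<=] K.
  rewrite inE => /and3P[KY IK KJ].
  have [p p1] := exists_point q_gt0 (iY _ _ KY K0Y); rewrite le_meet => /andP[pK pK0].
  by exists p; rewrite // inE le_bot le_meet pK0 (le_trans pK KJ).
have [p0 p0S _] := hit _ K1B.
have [p pS pmax] := @arg_maxnP _ p0 (mem S) (fun p => #|between (I [\/] p) J|) p0S.
have rp : rk p = 1 := itv_rkE pS.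
have [pK0 pJ] : p [<=] K0 /\ p [<=] J.
  by move: (itv_ger pS); rewrite le_meet => /andP.
exists (I [\/] p); split; first exact: join_gel.
- by rewrite le_join IJ pJ.
- have := rk_modular I p; have : rk (I [/\] p) <= rk (K0 [/\] I).
    by apply: le_rk; rewrite le_meet meet_lel (le_trans (meet_ler _ _) pK0).
  by rewrite K0I rp; lia.
rewrite -rS -card_points -/S -sum_nat_const.
apply: leq_trans (_ : \sum_(K in between I J) #|[set p in S | p [<=] K]| <= _).
  rewrite -sum1_card; apply: leq_sum => K /hit[p' p'S p'K].
  by apply/card_gt0P; exists p'; rewrite inE p'S p'K.
rewrite (sum_card_exchange _ _ (fun K p => p [<=] K)); apply: leq_sum => p' p'S.
apply: leq_trans (pmax _ p'S); apply: subset_leq_card; apply/subsetP=> K.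
by rewrite !inE le_join => /andP[/and3P[-> -> ->] ->].
Qed.

(** With [e = k.+1 - rk I] and [j = rk J - k.+1], the members drop by a factor at most [qnum q j],
    the interval by exactly [qnum q (e + j) / qnum q e]; [qnumM_leq] compares the two. *)
Lemma extend_up a s I J : I [<=] J -> dense a s I J -> ~~ stops I J ->
  exists I', [/\ I [<=] I', I' [<=] J, rk I' = (rk I).+1 & dense a s.+1 I' J].
Proof.
move=> IJ /andP[B0 dn] ns; have [I' [II' I'J rI' B]] := extend_up_card IJ B0 ns.
exists I'; split => //.
have B'0 : 0 < #|between I' J| by case: posnP B => // ->; rewrite muln0; lia.
have qj0 : 0 < qnum q (rk J - k.+1) by case: posnP B => // ->; lia.
have /card_gt0P[K] := B'0; rewrite inE => /and3P[KY I'K KJ].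
have rK := (proj1 Yint) _ KY.
have := le_rk I'K; rewrite rK rI' => ik.
have jk := le_rk KJ; rewrite rK in jk.
have HN : #|itv I J k.+1| * qnum q (k.+1 - rk I) = qnum q (rk J - rk I) * #|itv I' J k.+1|.
  apply: card_itv_up => // x xI.
  by rewrite !card_itv ?(itv_ger xI) ?(itv_rkE xI) ?rI'.
have qe0 : 0 < qnum q (k.+1 - rk I) by apply: qnum_gt0; lia.
have := qnumM_leq (k.+1 - rk I) (rk J - k.+1) q_gt0.
rewrite (_ : k.+1 - rk I + (rk J - k.+1) = rk J - rk I); last by lia.
rewrite /dense B'0 /= expnS; move: HN qe0 qj0 B dn.
move: #|itv I J k.+1| #|itv I' J k.+1| #|between I J| #|between I' J| => N N' b b'.
move: (qnum q (k.+1 - rk I)) (qnum q (rk J - rk I)) (qnum q (rk J - k.+1)) => e t j.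
move: (nspaces q k) (q.-1 ^ s) => f Q.
move=> HN e0 j0 B dn ej.
rewrite -(leq_pmul2r e0) -(leq_pmul2r j0).
apply: leq_trans (_ : a * Q * (t * N') <= _).
  rewrite (_ : a * (q.-1 * Q) * N' * e * j = a * Q * (q.-1 * (e * j) * N')); last by ring.
  by rewrite leq_mul2l leq_mul2r ej !orbT.
rewrite -HN mulnA; apply: leq_trans (_ : b * f * e <= _); first by rewrite leq_mul2r dn orbT.
rewrite (_ : b' * f * e * j = j * b' * (f * e)); last by ring.
by rewrite -mulnA leq_mul2r B orbT.
Qed.

Lemma exists_hyperplane x : rk x < 2 * k.+1 -> exists2 h, hyperplane h & x [<=] h.
Proof.
move=> xn; have [h h1 xh] : exists2 h, @point q k (dual G) h & x [<=] h.
  by apply: (@exists_point _ _ (dual G)); rewrite //= subn_gt0.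
by exists h; rewrite // -dual_point.
Qed.

(** Union bound: each member contains a point of [I] or lies in a hyperplane above [J]. *)
Lemma card_stops a I J : stops I J ->
    (forall p, point p -> #|between p (top G)| <= a) ->
    (forall h, hyperplane h -> #|between (bot G) h| <= a) ->
  #|Y| <= (qnum q (rk I) + qnum q (2 * k.+1 - rk J)) * a.
Proof.
move=> /forallP st pa ha.
have <- : #|itv (bot G) I 1| = qnum q (rk I) by apply: card_points.
have <- : #|itv J (top G) (2 * k).+1| = qnum q (2 * k.+1 - rk J).
  by rewrite (@card_itv_coatom _ _ G) ?le_top ?rk_top //; lia.
apply: leq_trans (_ : \sum_(K in Y) (#|[set p in itv (bot G) I 1 | p [<=] K]|
    + #|[set h in itv J (top G) (2 * k).+1 | K [<=] h]|) <= _).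
  rewrite -sum1_card; apply: leq_sum => K KY; rewrite addn_gt0.
  have /orP[|] := implyP (st K) KY => [/(exists_point q_gt0)|/exists_hyperplane] [x x1].
    rewrite le_meet => /andP[xK xI]; apply/orP; left; apply/card_gt0P; exists x.
    by rewrite !inE le_bot xI xK (eqP x1).
  rewrite le_join => /andP[Kx Jx]; apply/orP; right; apply/card_gt0P; exists x.
  by rewrite !inE le_top Jx Kx (eqP x1) eqxx.
rewrite big_split mulnDl -!sum_nat_const; apply: leq_add.
  rewrite (sum_card_exchange _ _ (fun K p => p [<=] K)); apply: leq_sum => p pI.
  apply: leq_trans (pa p _); last by rewrite /point (itv_rkE pI).
  by apply: subset_leq_card; apply/subsetP=> K; rewrite !inE le_top andbT.
rewrite (sum_card_exchange _ _ (@le _ _ G)); apply: leq_sum => h hJ.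
apply: leq_trans (ha h _); last by rewrite /hyperplane (itv_rkE hJ).
by apply: subset_leq_card; apply/subsetP=> K; rewrite !inE le_bot.
Qed.

End Between.

Section DualBetween.
Variables (q k : nat) (G : geometry q (2 * k.+1)).
Variable Y : {set G}.
Implicit Types I J : G.

Lemma dual_between I J : #|@between q k (dual G) Y J I| = #|between Y I J|.
Proof. by apply: eq_card => K; rewrite !inE [X in _ && X]andbC. Qed.

Lemma dual_dense a s I J : @dense q k (dual G) Y a s J I = dense Y a s I J.
Proof.
rewrite /dense dual_between; congr (_ && (_ * _ <= _)); apply: eq_card => K.
by rewrite !inE /= dual_middle andbCA.
Qed.

Lemma dual_stops I J : @stops q k (dual G) Y J I = stops Y I J.
Proof.
apply: eq_forallb => K; congr (_ ==> _) => /=; rewrite orbC subn_gt0; congr (_ || _).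
by have := rk_le_top (K [/\] I); lia.
Qed.

(** By modularity, two elements of middle rank meet nontrivially exactly when they do not span the
    whole space. *)
Lemma dual_intersecting : intersecting Y -> @intersecting q k (dual G) Y.
Proof.
case=> rY iY; split=> [K KY | K L KY LY] /=.
  by apply/eqP; rewrite dual_middle rY.
have := @rk_modular _ _ G K L; rewrite (rY _ KY) (rY _ LY); have := iY _ _ KY LY.
by lia.
Qed.

End DualBetween.

(** * A weak Hilton-Milner theorem *)

Section WeakHiltonMilner.
Variables (q k : nat).
Hypothesis q_gt4 : 4 < q.

Lemma extend_down (G : geometry q (2 * k.+1)) (Y : {set G}) a s (I J : G) :
    intersecting Y -> I [<=] J -> dense Y a s I J -> ~~ stops Y I J ->
  exists J', [/\ I [<=] J', J' [<=] J, (rk J').+1 = rk J & dense Y a s.+1 I J'].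
Proof.
move=> Yint IJ dn ns.
have q_gt1 : 1 < q by lia.
have [] := @extend_up _ _ _ _ (dual_intersecting Yint) q_gt1 a s J I.
- exact: IJ.
- by rewrite dual_dense.
- by rewrite dual_stops.
move=> J' [/= JJ' J'I rJ' dn']; exists J'; split => //.
  by have := rk_le_top J; have := rk_le_top J'; lia.
by rewrite -dual_dense.
Qed.

(* Starting from the interval above [p], lower [J] and raise [I] in turn: each
   step multiplies the density of [Y] by at least [q - 1]. *)
Lemma chain (G : geometry q (2 * k.+1)) (Y : {set G}) p s :
    intersecting Y -> point p -> 0 < #|between Y p (top G)| ->
    ~~ [forall K in Y, p [<=] K] ->
  (exists t I J, [/\ 0 < t <= s, rk I = t./2.+1, 2 * k.+1 - rk J = uphalf t
     & stops Y I J])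
  \/ (exists I J, [/\ I [<=] J, rk I = s.+1./2.+1, 2 * k.+1 - rk J = uphalf s.+1
     & dense Y #|between Y p (top G)| s.+1 I J]).
Proof.
move=> Yint p1 a0 np; set a := #|_|; have q_gt0 : 0 < q by lia.
elim: s => [|s [[t [I [J [ts rI rJ st]]]]|[I [J [IJ rI rJ dn]]]]].
- right; have [||J' [pJ' J'n rJ' dn]] := @extend_down G Y a 0 p (top G) Yint (le_top p).
  + by rewrite /dense a0 expn0 muln1 (card_on_point q_gt0 p1) leqnn.
  (* Every [K] spans with the top, so stopping at once would put [p] in all members. *)
  + apply: contra np => /forallP st; apply/forallP=> K; apply/implyP=> KY.
    have /orP[pK|] := implyP (st K) KY; last first.
      by have := le_rk (join_ger K (top G)); rewrite rk_top ltnNge => ->.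
    have <- : K [/\] p = p by apply: le_eq (meet_ler _ _) _; rewrite (eqP p1).
    exact: meet_lel.
  exists p, J'; split => //; first exact/eqP.
  by move: rJ'; rewrite rk_top /=; lia.
- by left; exists t, I, J; split => //; lia.
case: (boolP (stops Y I J)) => st; first by left; exists s.+1, I, J; rewrite leqnn.
(* After an odd number of steps [I] is raised, after an even number [J] is lowered. *)
right; case: (boolP (odd s.+1)) => sodd.
  have [I' [II' I'J rI' dn']] := extend_up Yint (ltac:(lia) : 1 < q) IJ dn st.
  by exists I', J; split => //; lia.
have [J' [IJ' J'J rJ' dn']] := extend_down Yint IJ dn st.
by exists I, J'; split => //; lia.
Qed.

(** Raising [t] by 2 multiplies the left side by at most [q + 1] and the right side by
    [(q - 1) ^ 2]. The case [t = 1] is [4 <= q - 1], tight at [q = 5]. *)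
Lemma qnum_chain_bound t : 0 < t ->
  2 * (qnum q t./2.+1 + qnum q (uphalf t)) <= q.-1 ^ t.
Proof.
have qS m : 0 < m -> qnum q m.+1 <= (q + 1) * qnum q m.
  move=> m0; rewrite -add1n qnumD expn1 qnum1 mulnDl mul1n leq_add2l.
  exact: qnum_gt0.
have [n] := ubnP t; elim: n t => // n IH [|[|[|t]]] // tn _.
- by rewrite /= qnum1 expn1; lia.
- by rewrite /= !qnumS qnum0 expn1 expn0 -mulnn; nia.
have {}IH := IH t.+1 ltac:(lia) isT.
rewrite 2!expnS mulnA; apply: leq_trans (leq_mul (_ : q + 1 <= _) IH); last by nia.
have h1 := qS (t.+1)./2.+1 isT.
have h2 := qS (uphalf t.+1) isT.
rewrite (_ : t.+3./2.+1 = t.+1./2.+2) // (_ : uphalf t.+3 = (uphalf t.+1).+1) //.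
by rewrite [leqRHS]mulnCA leq_mul2l mulnDr leq_add.
Qed.

Lemma hilton_milner_point (G : geometry q (2 * k.+1)) (Y : {set G}) p :
    intersecting Y -> point p -> 0 < #|between Y p (top G)| ->
    ~~ [forall K in Y, p [<=] K] ->
    (forall p', point p' -> #|between Y p' (top G)| <= #|between Y p (top G)|) ->
    (forall h, hyperplane h -> #|between Y (bot G) h| <= #|between Y p (top G)|) ->
  2 * #|Y| <= nspaces q k.
Proof.
move=> Yint p1 a0 np pmax hmax; set a := #|_| in a0 pmax hmax.
have q_gt0 : 0 < q by lia.
have sub (I J : G) : #|between Y I J| <= #|itv I J k.+1|.
  apply: subset_leq_card; apply/subsetP=> K; rewrite !inE => /and3P[KY -> ->].
  by rewrite (proj1 Yint) ?eqxx.
(* At the least such exponent, a chain that has not stopped would have density above 1, so the chain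
   stops earlier, where [a * q.-1 ^ t] is still at most [nspaces q k]. *)
have ex : exists s, nspaces q k < a * q.-1 ^ s.
  exists (nspaces q k); apply: leq_trans (leq_pmull _ a0).
  by apply: ltn_expl; lia.
case: (ex_minnP ex) => [[|s]] big_s min_s.
  move: big_s; rewrite expn0 muln1 ltnNge -(card_on_point q_gt0 p1).
  by rewrite sub.
have small_s : a * q.-1 ^ s <= nspaces q k.
  by rewrite leqNgt; apply/negP=> /min_s; rewrite ltnn.
have [[t [I [J [/andP[t0 ts] rI rJ st]]]]|[I [J [IJ rI rJ /andP[B0 dn]]]]] :=
  chain s Yint p1 a0 np; last first.
  move: dn; rewrite -/a leqNgt => /negP[].
  apply: leq_trans (_ : #|between Y I J| * (nspaces q k).+1 <= _).
    by rewrite ltn_mul2l B0 ltnSn.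
  by rewrite mulnC leq_mul.
have := card_stops (ltac:(lia) : 1 < q) st pmax hmax; rewrite rI rJ => cY.
apply: leq_trans small_s; rewrite mulnC.
apply: leq_trans (_ : q.-1 ^ t * a <= _); last first.
  by rewrite mulnC leq_mul2l leq_pexp2l ?orbT //; lia.
apply: leq_trans (leq_mul (qnum_chain_bound t0) (leqnn a)).
by rewrite mulnC -mulnA leq_mul2l cY orbT.
Qed.

(** Duality allows starting from whichever is more popular, the best point or the best
    hyperplane. *)
Theorem weak_hilton_milner (G : geometry q (2 * k.+1)) (Y : {set G}) :
    intersecting Y ->
    (forall p, point p -> ~~ [forall K in Y, p [<=] K]) ->
    (forall h, hyperplane h -> ~~ [forall K in Y, K [<=] h]) ->
  2 * #|Y| <= nspaces q k.
Proof.
move=> Yint np nh; have q_gt0 : 0 < q by lia.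
have q_gt1 : 1 < q by lia.
case: (set_0Vmem Y) => [->|[K0 K0Y]]; first by rewrite cards0.
have rK0 := (proj1 Yint) _ K0Y.
have [p0 p01 p0K] : exists2 p, point p & p [<=] K0 by apply: exists_point; rewrite ?rK0.
have [h0 h01 h0K] : exists2 h, hyperplane h & K0 [<=] h.
  by apply: exists_hyperplane; rewrite ?rK0 //; lia.
have [p p1 pmax] := @arg_maxnP _ p0 (@point _ _ G) (fun p => #|between Y p (top G)|) p01.
have [h h1 hmax] := @arg_maxnP _ h0 (@hyperplane _ _ G) (fun h => #|between Y (bot G) h|) h01.
have a0 : 0 < #|between Y p (top G)|.
  by apply: leq_trans (pmax p0 p01); apply/card_gt0P; exists K0; rewrite inE K0Y p0K le_top.
have b0 : 0 < #|between Y (bot G) h|.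
  by apply: leq_trans (hmax h0 h01); apply/card_gt0P; exists K0; rewrite inE K0Y h0K le_bot.
case: (leqP #|between Y (bot G) h| #|between Y p (top G)|) => ab.
  apply: (hilton_milner_point Yint p1 a0 (np p p1) pmax) => h' h'1.
  exact: leq_trans (hmax h' h'1) ab.
have := @hilton_milner_point (dual G) Y h (dual_intersecting Yint).
rewrite dual_point (dual_between Y (bot G) h); apply => //.
- exact: nh.
- by move=> h'; rewrite dual_point (dual_between Y (bot G)) => /hmax.
move=> p'; rewrite dual_hyperplane (dual_between Y p') => p'1.
exact: leq_trans (pmax p' p'1) (ltnW ab).
Qed.

End WeakHiltonMilner.

(** * Colourings *)

Section Colouring.
Variables (q k : nat) (G : geometry q (2 * k.+1)).
Implicit Types (K L p h : G).

Definition kneser_colouring (m : nat) (c : G -> 'I_m) : Prop :=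
  forall K L, rk K = k.+1 -> rk L = k.+1 -> rk (K [/\] L) = 0 -> c K <> c L.

Lemma kneser_colours_ge m (c : G -> 'I_m) : 4 < q -> kneser_colouring c ->
  q ^ k.+1 + q ^ k <= m.
Proof.
move=> q4 cP; rewrite leqNgt; apply/negP=> m_lt; have q0 : 0 < q by lia.
pose cl i := [set K : G | (rk K == k.+1) && (c K == i)].
have cl_int i : intersecting (cl i).
  split=> [K|K L]; rewrite !inE; first by case/andP=> /eqP.
  case/andP=> /eqP rK /eqP cK /andP[/eqP rL /eqP cL].
  by rewrite lt0n; apply/eqP=> /(cP _ _ rK rL); rewrite cK cL.
pose onp i p := point p && [forall K in cl i, p [<=] K].
pose inh i h := hyperplane h && [forall K in cl i, K [<=] h].
(* An empty class falls here, as the condition on its members is vacuous. *)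
pose PI := [set i | [exists p, onp i p]].
pose HI := [set i | ~~ [exists p, onp i p] && [exists h, inh i h]].
pose OI := [set i | ~~ [exists p, onp i p] && ~~ [exists h, inh i h]].
have cm : #|PI| + #|HI| + #|OI| = m.
  rewrite -[RHS](card_ord m) -(cardsC PI) -addnA; congr (_ + _).
  rewrite -(cardsID [set i | [exists h, inh i h]] (~: PI)); congr (_ + _).
    by apply: eq_card => i; rewrite !inE.
  by apply: eq_card => i; rewrite !inE andbC.
pose fp i := odflt (bot G) [pick p | onp i p].
pose fh i := odflt (bot G) [pick h | inh i h].
have fpP i : i \in PI -> onp i (fp i).
  rewrite inE /fp => /existsP[p op]; case: pickP => [//|/(_ p)]; by rewrite op.
have fhP i : i \in HI -> inh i (fh i).
  rewrite inE /fh => /andP[_ /existsP[h op]]; case: pickP => [//|/(_ h)]; by rewrite op.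
pose M := fp @: PI; pose Hs := fh @: HI.
have MP : {in M, forall p, point p} by move=> _ /imsetP[i /fpP/andP[pp _] ->].
have HH : {in Hs, forall h, hyperplane h} by move=> _ /imsetP[i /fhP/andP[pp _] ->].
have leM : #|M| <= #|PI| := leq_imset_card _ _.
have leH : #|Hs| <= #|HI| := leq_imset_card _ _.
have mhr : #|M| + #|Hs| + (q ^ k.+1 + q ^ k - #|M| - #|Hs|) = q ^ k.+1 + q ^ k by lia.
have := cover_bound q4 MP HH mhr; set r := _ - _ - _ in mhr * => cov.
(* A class in [PI] or [HI] consists of covered elements, so uncovered ones have colours in [OI],
   whose classes are small by [weak_hilton_milner]. *)
have UO : 2 * #|uncovered M Hs| <= #|OI| * nspaces q k.
  rewrite -[#|uncovered M Hs|]sum1_card (partition_big c (mem OI)) /=; last first.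
    move=> K; rewrite !inE => /and3P[rK K0 K1]; rewrite -negb_or; apply/negP.
    have Kcl : K \in cl (c K) by rewrite inE rK eqxx.
    case: (boolP [exists p, onp (c K) p]) => [eP _|nP /=].
      have cPI : c K \in PI by rewrite inE.
      have /andP[_ /forallP/(_ K)] := fpP _ cPI; rewrite Kcl /= => pK.
      have := in_set0 (fp (c K)); rewrite -(cards0_eq (eqP K0)) inE pK andbT.
      by move/negP; apply; apply: imset_f.
    move=> eH; have cHI : c K \in HI by rewrite inE nP eH.
    have /andP[_ /forallP/(_ K)] := fhP _ cHI; rewrite Kcl /= => hK.
    have := in_set0 (fh (c K)); rewrite -(cards0_eq (eqP K1)) inE hK andbT.
    by move/negP; apply; apply: imset_f.
  rewrite big_distrr /= -sum_nat_const; apply: leq_sum => i.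
  rewrite inE => /andP[/existsPn nP /existsPn nH].
  apply: leq_trans (weak_hilton_milner q4 (cl_int i) _ _).
  - rewrite leq_mul2l /= sum1dep_card; apply: subset_leq_card; apply/subsetP=> K.
    by rewrite !inE => /andP[/andP[-> _] ->].
  - by move=> p pp; have := nP p; rewrite /onp pp.
  - by move=> h hh; have := nH h; rewrite /inh hh.
have := leq_trans cov UO; rewrite mulnC leq_pmul2r ?(nspaces_gt0 G) //.
by lia.
Qed.

(* For [S] of rank [k.+1] inside [T] of rank [k.+2], the colours are the points
   of [T] outside [S] and the hyperplanes above [S] but not above [T]. *)
Lemma kneser_colouring_exists : 0 < q ->
  exists c : G -> 'I_(q ^ k.+1 + q ^ k), kneser_colouring c.
Proof.
move=> q0.
have [S _ rS] : exists2 S, bot G [<=] S & rk S = k.+1.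
  by apply: exists_rk; rewrite rk_bot; lia.
have [T ST rT] : exists2 T, S [<=] T & rk T = k.+2.
  by apply: exists_rk; rewrite rS; lia.
pose PT := itv (bot G) T 1 :\: itv (bot G) S 1.
pose HT := itv S (top G) (2 * k).+1 :\: itv T (top G) (2 * k).+1.
have cP : #|PT| = q ^ k.+1.
  rewrite cardsD (setIidPr _).
    by rewrite !card_points rS rT qnumS addnK.
  by apply/subsetP=> p; rewrite !inE le_bot => /and3P[_ /le_trans-> // ->].
have cH : #|HT| = q ^ k.
  rewrite cardsD (setIidPr _).
    rewrite !(@card_itv_coatom _ _ G) ?le_top ?rk_top ?rS ?rT //; try lia.
    rewrite (_ : 2 * k.+1 - k.+1 = k.+1); last by lia.
    by rewrite (_ : 2 * k.+1 - k.+2 = k) ?qnumS ?addnK //; lia.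
  by apply/subsetP=> h; rewrite !inE => /and3P[/(le_trans ST)-> -> ->].
pose D := ({p : G | p \in PT} + {h : G | h \in HT})%type.
have cD : #|{: D}| = q ^ k.+1 + q ^ k by rewrite card_sum !card_sig cP cH.
pose good K (d : D) :=
  match d with inl p => val p [<=] K | inr h => K [<=] val h end.
have main K : rk K = k.+1 -> exists d, good K d.
  move=> rK; case: (boolP (K [/\] T [<=] S)) => [KTS|nKTS]; last first.
    have [p [p1 pKT pS]] := point_notin q0 nKTS.
    move: pKT; rewrite le_meet => /andP[pK pT].
    have pPT : p \in PT by rewrite !inE le_bot (negPf pS) pT p1.
    by exists (inl (exist _ p pPT)).
  have KSE : K [/\] S = K [/\] T.
    apply: le_anti; rewrite !le_meet !meet_lel /= ?KTS //.
    exact: le_trans (meet_ler _ _) ST.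
  (* Otherwise [S] and [T] would have the same meet and join with [K], although their ranks
     differ. *)
  have nT : ~~ (T [<=] K [\/] S).
    apply/negP=> TKS; have := rk_modular K S; have := rk_modular K T.
    have -> : K [\/] T = K [\/] S.
      apply: le_anti; rewrite !le_join join_gel /= ?TKS ?join_gel //.
      exact: le_trans ST (join_ger _ _).
    by rewrite KSE rS rT; lia.
  have [h [/= h1 KSh Th]] := @point_notin _ _ (dual G) (K [\/] S) T q0 nT.
  move: KSh; rewrite le_join => /andP[Kh Sh].
  have hHT : h \in HT.
    rewrite !inE le_top (negPf Th) Sh /=.
    by have := @rk_le_top _ _ G h; lia.
  by exists (inr (exist _ h hHT)).
have [d0 _] := main S rS.
have [f fP] : exists f : G -> D, forall K, rk K = k.+1 -> good K (f K).
  apply: (@fin_all_exists G (fun=> D) (fun K d => rk K = k.+1 -> good K d)) => K.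
  case: (eqVneq (rk K) k.+1) => [/main[d gd]|/eqP nK]; first by exists d.
  by exists d0 => /nK.
exists (fun K => cast_ord cD (enum_rank (f K))) => K L rK rL KL0.
move=> /cast_ord_inj/enum_rank_inj fKL; have := fP K rK; rewrite fKL.
(* A shared point makes [K] and [L] meet; a shared hyperplane keeps them from spanning. *)
have := fP L rL; case: (f L) => -[x /= xI] xL xK.
  have : rk x <= rk (K [/\] L) by apply: le_rk; rewrite le_meet xL xK.
  by move: xI; rewrite KL0 inE => /andP[_ /itv_rkE ->].
have : rk (K [\/] L) <= rk x by apply: le_rk; rewrite le_join xL xK.
move: xI; rewrite inE => /andP[_ /itv_rkE ->].
by have := rk_modular K L; rewrite rK rL KL0; lia.
Qed.

End Colouring.

(** * The geometry of subspaces *)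

Section SubspaceGeometry.
Variables (F : finFieldType) (n : nat).

(** Finiteness is transported from the matrices that encode subspaces. *)
Definition subspace : finType := can_type (@VectorInternalTheory.vs2mxK F 'rV[F]_n).
Implicit Types U W Z : {vspace 'rV[F]_n}.

Definition atoms U W : {set subspace} :=
  [set Z : subspace | [&& (U <= Z)%VS, (Z <= W)%VS & \dim Z == (\dim U).+1]].
Definition coatoms U W : {set subspace} :=
  [set Z : subspace | [&& (U <= Z)%VS, (Z <= W)%VS & (\dim Z).+1 == \dim W]].

Lemma card_vectors U : #|[set v in U]| = #|F| ^ \dim U.
Proof. by rewrite cardsE -card_vspace. Qed.

(** Each vector of [W] outside [U] spans an atom with [U], and each atom arises from
    [#|F| ^ \dim U * (#|F| - 1)] vectors. *)
Lemma card_subspace_atoms U W : (U <= W)%VS ->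
  #|atoms U W| = qnum #|F| (\dim W - \dim U).
Proof.
move=> UW; have q1 : 1 < #|F| := finNzRing_gt1 F.
have q0 : 0 < #|F| by lia.
have dUW := dimvS UW.
have fib (Z : subspace) : Z \in atoms U W ->
    #|[set v in W | (v \notin U) && ((U + <[v]>)%VS == Z)]| = #|F| ^ \dim U * #|F|.-1.
  rewrite inE => /and3P[UZ ZW /eqP dZ].
  rewrite (_ : [set v in W | _] = [set v in Z] :\: [set v in U]).
    rewrite cardsD (setIidPr _) ?card_vectors ?dZ; last first.
      by apply/subsetP=> v; rewrite !inE => /(subvP UZ).
    by rewrite expnS mulnC -subn1 mulnBr muln1.
  apply/setP=> v; rewrite !inE; apply/and3P/andP => [[vW vU /eqP <-]|[vU vZ]].
    by split=> //; apply: (subvP (addvSr _ _)); rewrite memv_line.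
  split; rewrite ?(subvP ZW) // eqEdim subv_add UZ -memvE vZ dZ /=.
  rewrite ltn_neqAle dimvS ?addvSl // andbT; apply: contra vU => /eqP dE.
  have /eqP -> : U == (U + <[v]>)%VS by rewrite eqEdim addvSl dE leqnn.
  by apply: (subvP (addvSr _ _)); rewrite memv_line.
have tot : #|[set v in W] :\: [set v in U]| = #|atoms U W| * (#|F| ^ \dim U * #|F|.-1).
  rewrite -sum1_card.
  rewrite (partition_big (fun v => (U + <[v]>)%VS : subspace) (mem (atoms U W))) /=.
    rewrite -sum_nat_const; apply: eq_bigr => Z /fib <-.
    rewrite sum1dep_card; apply: eq_card => v; rewrite !inE.
    by case: (v \in W); rewrite ?andbF ?andbT.
  move=> v; rewrite !inE => /andP[vU vW].
  rewrite addvSl subv_add UW -memvE vW /=.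
  have dv : \dim <[v]> = 1.
    by rewrite dim_vline; have -> : v != 0%R by apply: contraNneq vU => ->; rewrite mem0v.
  have dc : \dim (U :&: <[v]>) = 0.
    suff : \dim (U :&: <[v]>) < \dim <[v]> by rewrite dv; lia.
    rewrite ltnNge; apply: contra vU => le_v.
    have /eqP E : (U :&: <[v]>)%VS == <[v]>%VS by rewrite eqEdim capvSr.
    by rewrite memvE -E capvSl.
  by have := dimv_sum_cap U <[v]>; rewrite dv dc addn0 addn1 => ->.
move: tot; rewrite cardsD (setIidPr _); last first.
  by apply/subsetP=> v; rewrite !inE => /(subvP UW).
rewrite !card_vectors -{1}(subnKC dUW) expnD -{2}(muln1 (_ ^ \dim U)) -mulnBr.
rewrite mulnCA => /eqP; rewrite eqn_pmul2l ?expn_gt0 ?q0 // => /eqP.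
have <- := qnum_exp (\dim W - \dim U) q0; rewrite addnK mulnC => /eqP.
by rewrite eqn_pmul2r => [/eqP|]; lia.
Qed.

(** Induction on the codimension: each atom is below [qnum #|F| d] coatoms and each coatom is above
    as many atoms, so there are equally many of both. *)
Lemma card_subspace_coatoms U W : (U <= W)%VS ->
  #|coatoms U W| = qnum #|F| (\dim W - \dim U).
Proof.
move=> UW; have := dimvS UW; move/subnKC.
move: (\dim W - \dim U) => d; elim: d U UW => [|d IH] U UW dUW.
  rewrite qnum0; apply: eq_card0 => Z; rewrite !inE; apply/negP.
  by case/and3P=> /dimvS + _ /eqP; lia.
(* Codimension 1 is separate because [qnum #|F| 0 = 0] cannot be cancelled. *)
case: (posnP d) => [d0|d0].
  rewrite d0 qnum1 -(cards1 (U : subspace)); apply: eq_card => Z; rewrite !inE.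
  apply/and3P/eqP => [[UZ ZW /eqP dZ]|->]; last by rewrite subvv UW; split => //; lia.
  have /eqP E : (U == Z :> {vspace 'rV[F]_n}) by rewrite eqEdim UZ; lia.
  exact: esym E.
have := sum_card_exchange (atoms U W) (coatoms U W) (fun Z Z' : {vspace 'rV[F]_n} => (Z <= Z')%VS).
rewrite (eq_bigr (fun=> qnum #|F| d)); last first.
  move=> Z; rewrite inE => /and3P[UZ ZW /eqP dZ].
  rewrite -(IH Z ZW); last by lia.
  apply: eq_card => X; rewrite !inE.
  case: (boolP (Z <= X)%VS) => ZX; last by rewrite andbF.
  by rewrite (subv_trans UZ ZX) andbT.
rewrite [RHS](eq_bigr (fun=> qnum #|F| d)); last first.
  move=> X; rewrite inE => /and3P[UX XW /eqP dX].
  rewrite (_ : d = \dim X - \dim U); last by lia.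
  rewrite -card_subspace_atoms //; apply: eq_card => Z; rewrite !inE.
  case: (boolP (Z <= X)%VS) => ZX; last by rewrite !andbF.
  by rewrite (subv_trans ZX XW) andbT.
rewrite !sum_nat_const => /eqP; rewrite eqn_pmul2r ?qnum_gt0 // => /eqP <-.
by rewrite card_subspace_atoms //; congr qnum; lia.
Qed.

Definition subspace_geometry : geometry #|F| n.
Proof.
refine (@Geometry #|F| n subspace
  (fun U W : {vspace 'rV[F]_n} => (U <= W)%VS)
  (fun U W : {vspace 'rV[F]_n} => (U :&: W)%VS)
  (fun U W : {vspace 'rV[F]_n} => (U + W)%VS)
  (fun U : {vspace 'rV[F]_n} => \dim U)
  0%VS fullv _ _ _ _ _ _ _ _ _ _ _ card_subspace_atoms card_subspace_coatoms).
- exact: subvv.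
- by move=> W U Z; apply: subv_trans.
- by move=> U W Z; rewrite subv_cap.
- by move=> U W Z; rewrite subv_add.
- by move=> U W; apply: dimvS.
- by move=> U W UW dWU; have /eqP E : (U == W :> {vspace 'rV[F]_n}) by rewrite eqEdim UW.
- by move=> U W; rewrite addnC dimv_sum_cap.
- exact: sub0v.
- exact: subvf.
- exact: dimv0.
- by rewrite dimvf /dim /= mul1n.
Defined.

End SubspaceGeometry.

(** * Transfer to the [q]-Kneser graph *)

Theorem theorem3 (q k : nat) (F : finFieldType) (hF : #|F| = q)
    (hq : 5 <= q) (hk : 1 <= k) :
  is_chromatic_number (@qKneser F (2 * k) k) (q ^ k + q ^ (k - 1)).
Proof.
case: k hk => // k _; rewrite subn1 /=; subst q.
pose G := subspace_geometry F (2 * k.+1).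
have q0 : 0 < #|F| by lia.
split=> [|m [c cP]].
  have [c cP] := kneser_colouring_exists G q0.
  exists (fun U => c (val U)) => U W /eqP UW0; apply: cP.
  - exact/eqP/(valP U).
  - exact/eqP/(valP W).
  by rewrite /= UW0 dimv0.
have [S _ rS] : exists2 S : G, bot G [<=] S & rk S = k.+1.
  by apply: exists_rk; rewrite rk_bot; lia.
pose S0 : qKneser_vertex F (2 * k.+1) k.+1 := exist _ (S : {vspace _}) (introT eqP rS).
(* The colouring of vertices is extended to all subspaces, with [S0] as the default vertex for other
   dimensions. *)
pose vtx (K : G) : qKneser_vertex F (2 * k.+1) k.+1 := insubd S0 (K : {vspace _}).
have vtxE (K : G) : rk K = k.+1 -> val (vtx K) = K.
  by move=> rK; apply: (@insubdK _ _ _ S0); rewrite -topredE /=; apply/eqP.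
apply: (@kneser_colours_ge _ k G m (c \o vtx)) => // K L rK rL KL0.
apply: cP; rewrite /qKneser !vtxE // -dimv_eq0; exact/eqP.
Qed.
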